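(* Let $\theta>0$ and let $M_n=\max\{X_1,\dots,X_n\}$ be the maximum of a size $n$ sample from the $\mathsf{GEM}(\theta)$ distribution. Then $$\frac{M_n-\theta\log n}{\sqrt{\theta\log n}}\overset{d}{\to}N,\qquad n\to\infty,$$ where $N$ has the standard normal distribution and $\overset{d}{\to}$ denotes convergence in distribution.
   Context: $\mathbb{N}=\{1,2,\dots\}$. Sample from the $\mathsf{GEM}(\theta)$ distribution ($\theta>0$): let $H_1,H_2,\dots$ be i.i.d. random variables with the beta$(1,\theta)$ distribution, i.e. with density $\theta(1-x)^{\theta-1}$ on $[0,1]$, and put $Y_k=1-\prod_{i=1}^k(1-H_i)$ for $k\in\mathbb{N}$; then $Y_k\uparrow1$ a.s. Given $\mathbf{Y}=(Y_k)_{k\ge1}$, the variables $X_1,X_2,\dots$ are i.i.d. with values in $\mathbb{N}$ and $\mathbb{P}[X_1\le k\mid\mathbf{Y}]=Y_k$ for all $k\in\mathbb{N}$. The convergence in distribution is with respect to the unconditional law. *)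

(* Defs.v *)
From HB Require Import structures.
From mathcomp Require Export all_boot all_order all_algebra finmap.
From mathcomp Require Export all_classical all_reals all_analysis measurable_realfun.
Set Implicit Arguments.
Unset Strict Implicit.
Unset Printing Implicit Defensive.
Import Order.TTheory GRing.Theory Num.Theory.
Import numFieldNormedType.Exports.
Local Open Scope classical_set_scope.
Local Open Scope ring_scope.

Section independence.
Context {d d' : measure_display} {T : measurableType d} {T' : measurableType d'}
  {R : realType} (P : probability T R).
Implicit Types (G : set (set T)) (X : nat -> T -> T').

Definition mutually_independent X : Prop :=
  forall (J : {fset nat}) (A : nat -> set T'),
    (forall j, measurable (A j)) ->
    P (\bigcap_(j in [set` J]) (X j @^-1` A j)) =
      (\prod_(j <- J) P (X j @^-1` A j))%E.

(* [f] is a version of the conditional expectation of [Z] given the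
   sub-sigma-algebra [G] *)
Definition is_cond_expectation G (Z f : T -> R) : Prop :=
  [/\ preimage_set_system [set: T] f measurable `<=` G,
      P.-integrable [set: T] (EFin \o f) &
      forall A, G A -> (\int[P]_(t in A) (f t)%:E = \int[P]_(t in A) (Z t)%:E)%E].

Definition is_cond_prob G (B : set T) (f : T -> R) : Prop :=
  is_cond_expectation G (\1_B : T -> R) f.

(* Conditional probabilities are only determined almost surely, so the product
   rule is required for all choices of versions [f j]. *)
Definition cond_independent G X : Prop :=
  forall (J : {fset nat}) (A : nat -> set T') (f : nat -> T -> R),
    (forall j, measurable (A j)) ->
    (forall j, j \in J -> is_cond_prob G (X j @^-1` A j) (f j)) ->
    is_cond_prob G (\bigcap_(j in [set` J]) (X j @^-1` A j))
      (fun t => \prod_(j <- J) f j t).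

End independence.

Definition sigma_generated {d d' : measure_display} {T : measurableType d}
    {T' : measurableType d'} (Y : nat -> T -> T') : set (set T) :=
  <<s \bigcup_k preimage_set_system [set: T] (Y k) measurable >>.

Definition cvg_in_distribution {d d' : measure_display} {T : measurableType d}
    {T' : measurableType d'} {R : realType} {P : probability T R}
    {P' : probability T' R}
    (Z : nat -> {RV P >-> R}) (N : {RV P' >-> R}) : Prop :=
  forall x : R, {for x, continuous (cdf N)} ->
    cdf (Z n) x @[n --> \oo] --> cdf N x.

(* Density of beta(1, theta); at the endpoint x = 1 it takes the value of
   [powR] at 0, which is irrelevant since a point is Lebesgue-negligible. *)
Definition beta1_pdf {R : realType} (theta x : R) : R :=
  theta * (1 - x) `^ (theta - 1) * \1_`[0, 1] x.

Section GEM.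
Context {d : measure_display} {T : measurableType d} {R : realType}
  {P : probability T R}.

(* Sequences are indexed from 0: [H i] stands for H_(i+1) (and likewise for the
   sample), while [stick H k] is Y_k itself, with Y_0 = 0. *)
Definition stick (H : nat -> {RV P >-> R}) (k : nat) (t : T) : R :=
  1 - \prod_(i < k) (1 - H i t).

Definition sample_max (X : nat -> {RV P >-> nat}) (n : nat) (t : T) : nat :=
  \max_(i < n) X i t.

Lemma measurable_sample_max X n : measurable_fun [set: T] (sample_max X n).
Proof.
elim: n => [|n IHn].
  rewrite (_ : sample_max X 0 = cst 0%N); first exact: measurable_cst.
  by apply/funext => t; rewrite /sample_max big_ord0.
rewrite (_ : sample_max X n.+1 = fun t => maxn (sample_max X n t) (X n t)).
  exact: measurable_fun_maxn.
by apply/funext => t; rewrite /sample_max big_ord_recr.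
Qed.

(* Only the values at n >= 2 are meaningful: for n <= 1, ln n = 0 and the
   quotient is 0 by convention. *)
Definition normalized_max (theta : R) (X : nat -> {RV P >-> nat}) (n : nat)
    (t : T) : R :=
  ((sample_max X n t)%:R - theta * ln n%:R) / Num.sqrt (theta * ln n%:R).

Lemma measurable_normalized_max theta X n :
  measurable_fun [set: T] (normalized_max theta X n).
Proof.
exact: (@measurableT_comp _ _ _ _ _ _
  (fun m : nat => (m%:R - theta * ln n%:R) / Num.sqrt (theta * ln n%:R) : R)
  _ (sample_max X n) _ (measurable_sample_max X n)).
Qed.

HB.instance Definition _ theta X n := isMeasurableFun.Build _ _ _ _
  (normalized_max theta X n) (measurable_normalized_max theta X n).

End GEM.

(* Main.v *)
Require Import Defs.
From mathcomp Require Import ring lra.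
Import Order.TTheory GRing.Theory Num.Theory.
Import numFieldNormedType.Exports.
Local Open Scope classical_set_scope.
Local Open Scope ring_scope.

(** Write W_k = prod_(i < k) (1 - H_i) for the length of stick left after k
breaks, so that Y_k = 1 - W_k. Conditional independence gives
P(M_n <= k) = E[Y_k ^ n] = E[(1 - W_k) ^ n] ([cond_iid_max_le]). Expanding by
the binomial formula, only the moments of W_k matter. Since 1 - H_i is
beta(theta, 1), its j-th moment is theta / (theta + j), and by independence
E[W_k ^ j] = (theta / (theta + j)) ^ k, whence P(M_n <= k) is an explicit
alternating sum ([gem_max_cdf]).

The numbers (theta / (theta + j)) ^ k are also the moments of exp(- t / theta)
when t has the Gamma(k) law, with density proportional to t ^ (k - 1) exp(- t).
So, without identifying the law of W_k, the same alternating sum is a quotient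
of two Gamma integrals: for k = m + 1,

  P(M_n <= m + 1) * int t^m e^(-t) dt = int (1 - e^(-t/theta))^n t^m e^(-t) dt

([gamma_profile_onemX]). Centre and scale by t = m - sqrt(m) u. Divided by its
maximum, the Gamma weight becomes (1 - u / sqrt m) ^ m exp(u sqrt m), which
tends to exp(- u^2 / 2) ([gamma_profile_cvg]) and is dominated by exp(1 - |u| / 2), uniformly in m
([gamma_profile_le]). If m = theta ln n + x sqrt(theta ln n) + O(1), then
n exp(- t / theta) tends to 0 for u < x and to infinity for u > x, so that
(1 - exp(- t / theta)) ^ n tends to the indicator of u <= x
([gamma_weight_cvg]). Dominated convergence in the numerator and in the
denominator yields the limit
int_(u <= x) exp(- u^2 / 2) du / int exp(- u^2 / 2) du,
the standard normal distribution function at x ([gem_sum_cvg]); the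
normalizing constant of the Gamma law enters only through this quotient. *)

(** * Nonnegative functions against weighted measures *)

Section weighted_integrals.
Import HBNNSimple.

Lemma ge0_integral_nnsfun_comp {d d' : measure_display}
    {T : measurableType d} {S : measurableType d'} {R : realType}
    (mu : {measure set T -> \bar R}) (w : T -> R) (p : T -> S)
    (g : {nnsfun S >-> R}) :
  measurable_fun setT w -> measurable_fun setT p -> (forall t, 0 <= w t) ->
  (\int[mu]_t (w t * g (p t))%:E =
   \sum_(k \in range g)
     (k%:E * \int[mu]_t (w t * \1_(g @^-1` [set k]) (p t))%:E))%E.
Proof.
move=> mw mp w0.
have mind k : measurable_fun setT (fun t => \1_(g @^-1` [set k]) (p t) : R).
  by apply: measurableT_comp.
have kind_ge0 (k : R) t : 0 <= k * \1_(g @^-1` [set k]) (p t).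
  by have := nnfun_muleindic_ge0 g k (p t); rewrite -EFinM lee_fin.
under eq_integral => t _.
  rewrite EFinM fimfunE -fsumEFin// ge0_mule_fsumr; last first.
    by move=> k; rewrite lee_fin.
  over.
rewrite ge0_integral_fsum//; last 2 first.
- move=> k; apply/measurable_EFinP => /=.
  by apply: measurable_funM => //; exact: measurable_funM.
- by move=> k t _; rewrite -EFinM lee_fin mulr_ge0.
apply: eq_fsbigr => k _.
have [k0|k0] := leP 0 k.
  rewrite -ge0_integralZl//.
  - by apply: eq_integral => t _; rewrite -!EFinM mulrCA.
  - by apply/measurable_EFinP; exact: measurable_funM.
  - by move=> t _; rewrite lee_fin mulr_ge0.
have gk0 : g @^-1` [set k] = set0 by exact: preimage_nnfun0.
rewrite gk0 !integral0_eq ?mule0// => t _; rewrite indic0 ?mulr0 ?mule0//.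
Qed.

(** Simple functions are dense from below, so integrals of f are determined by
those of indicators. Carrying a weight on each side lets this one statement
cover three uses: passing from a law given by a density to expectations,
replacing one factor at a time in a product of independent variables, and
changing variables. *)
Lemma ge0_eq_integral_weight {d1 d2 d : measure_display}
    {T1 : measurableType d1} {T2 : measurableType d2} {S : measurableType d}
    {R : realType}
    (mu1 : {measure set T1 -> \bar R}) (mu2 : {measure set T2 -> \bar R})
    (w1 : T1 -> R) (w2 : T2 -> R) (p1 : T1 -> S) (p2 : T2 -> S) :
  measurable_fun setT w1 -> measurable_fun setT w2 ->
  measurable_fun setT p1 -> measurable_fun setT p2 ->
  (forall t, 0 <= w1 t) -> (forall t, 0 <= w2 t) ->
  (forall A, measurable A ->
    (\int[mu1]_t (w1 t * \1_A (p1 t))%:E =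
     \int[mu2]_t (w2 t * \1_A (p2 t))%:E)%E) ->
  forall f : S -> R, measurable_fun setT f -> (forall s, 0 <= f s) ->
  (\int[mu1]_t (w1 t * f (p1 t))%:E = \int[mu2]_t (w2 t * f (p2 t))%:E)%E.
Proof.
move=> mw1 mw2 mp1 mp2 w10 w20 w12 f mf f0.
have mEf : measurable_fun setT (EFin \o f) by exact/measurable_EFinP.
pose g := nnsfun_approx measurableT mEf.
have fg s : (g n s)%:E @[n --> \oo] --> (f s)%:E.
  by apply: (cvg_nnsfun_approx measurableT mEf) => // t _; rewrite lee_fin.
have limg d' (T : measurableType d') (mu : {measure set T -> \bar R})
    (w : T -> R) (p : T -> S) : measurable_fun setT w ->
    measurable_fun setT p -> (forall t, 0 <= w t) ->
    (\int[mu]_t (w t * f (p t))%:E =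
     limn (fun n => \int[mu]_t (w t * g n (p t))%:E))%E.
  move=> mw mp w0; rewrite -monotone_convergence//.
  - apply: eq_integral => t _; apply/esym/cvg_lim => //.
    rewrite EFinM; apply: (@cvgeZl _ _ _ (fun n => (g n (p t))%:E)) => //.
  - move=> n; apply/measurable_EFinP/measurable_funM => //.
    exact: measurableT_comp.
  - by move=> n t _; rewrite lee_fin mulr_ge0.
  - move=> t _ m n mn; rewrite lee_fin ler_wpM2l//.
    exact/lefP/nd_nnsfun_approx.
rewrite limg// [RHS]limg//; congr (limn _); apply/funext => n.
by rewrite !ge0_integral_nnsfun_comp//; apply: eq_fsbigr => k _; rewrite w12.
Qed.

End weighted_integrals.

(** * Expectation of a product of independent variables *)

Lemma big_fset_iota {V : Type} {idx : V} (op : Monoid.com_law idx) (k : nat)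
    (F : nat -> V) :
  \big[op/idx]_(j <- [fset i in iota 0 k]%fset) F j = \big[op/idx]_(i < k) F i.
Proof.
rewrite -(big_mkord xpredT); apply: perm_big.
apply: uniq_perm; rewrite ?fset_uniq ?iota_uniq// => i.
by rewrite inE /index_iota subn0.
Qed.

Lemma measurable_bigprod {d : measure_display} {T : measurableType d}
    {R : realType} {I : Type} (r : seq I) (Q : pred I) (h : I -> T -> R) :
  (forall i, measurable_fun setT (h i)) ->
  measurable_fun setT (fun t => \prod_(i <- r | Q i) h i t).
Proof.
move=> mh; elim: r => [|i r IHr].
  by apply: (eq_measurable_fun (cst (1 : R))) => // t _; rewrite big_nil.
case Qi : (Q i).
  apply: (eq_measurable_fun (fun t => h i t * \prod_(i <- r | Q i) h i t)).
    by move=> t _; rewrite big_cons Qi.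
  exact: measurable_funM.
by apply: eq_measurable_fun IHr => t _; rewrite big_cons Qi.
Qed.

(** The product rule for indicators is the definition of independence. The
indicators are traded for the functions f i one index at a time: if the rule
holds with an arbitrary indicator in position m, then it holds with f m there
by [ge0_eq_integral_weight], the other factors forming the weight. *)
Lemma mutually_independent_integral_prod {d d' : measure_display}
    {T : measurableType d} {S : measurableType d'} {R : realType}
    (P : probability T R) (H : nat -> T -> S) (f : nat -> S -> R) (e : nat -> R)
    (k : nat) :
  mutually_independent P H ->
  (forall i, measurable_fun setT (H i)) ->
  (forall i, measurable_fun setT (f i)) -> (forall i s, 0 <= f i s) ->
  (forall i, (\int[P]_t (f i (H i t))%:E = (e i)%:E)%E) ->
  (\int[P]_t (\prod_(i < k) f i (H i t))%:E = (\prod_(i < k) e i)%:E)%E.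
Proof.
move=> indep mH mf f0 fe.
suff claim m : (m <= k)%N -> forall (g : nat -> S -> R) (e : nat -> R),
    (forall i, (m <= i)%N -> exists2 A, measurable A & g i = \1_A) ->
    (forall i, measurable_fun setT (g i)) -> (forall i s, 0 <= g i s) ->
    (forall i, (\int[P]_t (g i (H i t))%:E = (e i)%:E)%E) ->
    (\int[P]_t (\prod_(i < k) g i (H i t))%:E = (\prod_(i < k) e i)%:E)%E.
  (* Constant indicators from k on, so that the claim applies with m := k. *)
  pose g i := if (i < k)%N then f i else \1_setT.
  pose e' i := if (i < k)%N then e i else 1.
  transitivity (\int[P]_t (\prod_(i < k) g i (H i t))%:E)%E.
    apply: eq_integral => t _; congr EFin; apply: eq_bigr => i _.
    by rewrite /g ltn_ord.
  rewrite (claim k _ g e')//.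
  - by congr EFin; apply: eq_bigr => i _; rewrite /e' ltn_ord.
  - by move=> i ki; exists setT => //; rewrite /g ltnNge ki.
  - by move=> i; rewrite /g; case: ifP.
  - by move=> i s; rewrite /g; case: ifP.
  - move=> i; rewrite /g /e'; case: ifP => // _.
    by under eq_integral do rewrite indicT/=; rewrite integral_cst//= probability_setT mule1.
elim: m => [_|m IH mk] {}g {}e' gA mg g0 ge.
  have [A AP] : {A : nat -> set S & forall i, measurable (A i) /\ g i = \1_(A i)}.
    apply: (@choice _ _ (fun i A => measurable A /\ g i = \1_A)) => i.
    by have [A mA gA'] := gA i isT; exists A.
  have mHA i : measurable (H i @^-1` A i).
    by rewrite -[_ @^-1` _]setTI; apply: mH => //; case: (AP i).
  pose J := [fset i in iota 0 k]%fset.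
  have mJ : measurable (\bigcap_(j in [set` J]) (H j @^-1` A j)).
    by rewrite bigcap_fset; apply: bigsetI_measurable => j _; exact: mHA.
  transitivity (\int[P]_t (\1_(\bigcap_(j in [set` J]) (H j @^-1` A j)) t)%:E)%E.
    apply: eq_integral => t _; congr EFin.
    rewrite bigcap_fset -(big_fset_iota _ _ (fun i => g i (H i t))).
    elim/big_rec2 : _ => [|i x B _ ->]; first by rewrite indicT.
    by rewrite indicI/= (AP i).2.
  rewrite integral_indic// setIT.
  transitivity (\prod_(j <- J) P (H j @^-1` A j))%E.
    by apply: indep => j; case: (AP j).
  rewrite -prodEFin -(big_fset_iota _ _ (fun i => (e' i)%:E)).
  apply: eq_bigr => i _; rewrite -ge.
  transitivity (\int[P]_t (\1_(H i @^-1` A i) t)%:E)%E.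
    by rewrite integral_indic// setIT.
  by apply: eq_integral => t _; rewrite (AP i).2.
(* Isolate the factor of index m; the others form the weight w, whose integral
   against any indicator of H m is given by the previous step. *)
pose w t := \prod_(i < k | i != m :> nat) g i (H i t).
pose c := \prod_(i < k | i != m :> nat) e' i.
have wE t : \prod_(i < k) g i (H i t) = w t * g m (H m t).
  by rewrite (bigD1 (Ordinal mk))//= mulrC.
have cE : \prod_(i < k) e' i = c * e' m.
  by rewrite (bigD1 (Ordinal mk))//= mulrC.
have e0 i : 0 <= e' i.
  by rewrite -lee_fin -ge integral_ge0// => t _; rewrite lee_fin.
have cint (h : T -> R) : measurable_fun setT h -> (forall t, 0 <= h t) ->
    (\int[P]_t (cst c t * h t)%:E = c%:E * \int[P]_t (h t)%:E)%E.
  move=> mh h0; rewrite -ge0_integralZl//.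
  - exact/measurable_EFinP.
  - by move=> t _; rewrite lee_fin.
  - by rewrite lee_fin prodr_ge0.
under eq_integral do rewrite wE.
have := @ge0_eq_integral_weight _ _ _ _ _ _ _ P P w (cst c) (H m) (H m).
move=> /(_ _ _ _ _ _ _ _ (g m)) ->//.
- rewrite cint ?ge ?cE ?EFinM//; exact: measurableT_comp.
- by apply: measurable_bigprod => i; exact: measurableT_comp.
- by move=> t; rewrite prodr_ge0.
- by move=> t; rewrite prodr_ge0.
- move=> A mA.
  pose g' i := if i == m then \1_A else g i.
  pose e'' i := if i == m then fine (P (H m @^-1` A)) else e' i.
  have mHA : measurable (H m @^-1` A).
    by rewrite -[_ @^-1` _]setTI; exact: mH.
  have indA : (\int[P]_t (\1_A (H m t))%:E = P (H m @^-1` A))%E.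
    by rewrite -[X in _ = P X]setIT -integral_indic.
  have := IH (ltnW mk) g' e''.
  have e''E : \prod_(i < k) e'' i = c * fine (P (H m @^-1` A)).
    rewrite (bigD1 (Ordinal mk))//= mulrC /e'' eqxx; congr (_ * _).
    by apply: eq_bigr => i /negPf im; rewrite ifF.
  have g'E t : \prod_(i < k) g' i (H i t) = w t * \1_A (H m t).
    rewrite (bigD1 (Ordinal mk))//= mulrC /g' eqxx; congr (_ * _).
    by apply: eq_bigr => i /negPf im; rewrite ifF.
  move=> IHg; transitivity (\int[P]_t (\prod_(i < k) g' i (H i t))%:E)%E.
    by apply: eq_integral => t _; rewrite g'E.
  rewrite IHg.
  + rewrite e''E cint ?indA ?EFinM ?fineK ?fin_num_measure//.
    exact: measurableT_comp.
  + move=> i; rewrite leq_eqVlt => /predU1P[<-|mi].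
      by exists A => //; rewrite /g' eqxx.
    by have [B mB gB] := gA i mi; exists B => //; rewrite /g' gtn_eqF.
  + by move=> i; rewrite /g'; case: ifP => // _; exact: measurable_indic.
  + by move=> i s; rewrite /g'; case: ifP.
  + move=> i; rewrite /g' /e''; case: eqP => [->|//].
    by rewrite indA fineK// fin_num_measure.
Qed.

(** * Moments of the beta(1, theta) density *)

Lemma integral_indic_weight {d : measure_display} {T : measurableType d}
    {R : realType} (mu : {measure set T -> \bar R}) (A : set T) (f : T -> R) :
  (\int[mu]_(x in A) (f x)%:E = \int[mu]_x (f x * \1_A x)%:E)%E.
Proof.
rewrite integral_mkcond; apply: eq_integral => x _.
by rewrite patchE indicE; case: (x \in A); rewrite ?mulr1 ?mulr0.
Qed.

Section powR_integral.
Context {R : realType}.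
Implicit Types a : R.

(** The point 0 has to be treated apart: there only the right limit is
available, [powR] being constant equal to 1 on the negative half-line. *)
Lemma continuous_within_powR01 a : 0 < a ->
  {within `[0, 1], continuous (fun x : R => x `^ a)}.
Proof.
move=> a0.
have c x : 0 < x -> {for x, continuous (fun x : R => x `^ a)}.
  move=> x0; apply/differentiable_continuous/derivable1_diffP.
  by apply: derivable_powR; rewrite in_itv/= x0.
apply/continuous_within_itvP => //; split.
- by move=> x; rewrite in_itv/= => /andP[x0 _]; exact: c.
- by rewrite powR0 ?gt_eqF//; exact: powR_cvg0.
- by apply: cvg_at_left_filter; exact: c.
Qed.

Lemma integral_powR01 a : 0 < a ->
  (\int[lebesgue_measure]_(x in `[0%R, 1%R]) (x `^ a)%:E = ((a + 1)^-1)%:E)%E.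
Proof.
move=> a0; have a1 : 0 < a + 1 by rewrite addr_gt0.
pose F : R -> R := (a + 1)^-1 \*: (@powR R ^~ (a + 1)).
have d (x : R) : 0 < x -> is_derive x 1 F (x `^ a).
  move=> x0; have := is_deriveZ (a + 1)^-1 (@is_derive1_powR R (a + 1) x x0).
  by rewrite addrK => dx; apply: is_derive_eq; rewrite scalerA mulVf ?gt_eqF// scale1r.
have /(continuous_within_itvP _ ltr01)[_ c0 c1] := continuous_within_powR01 _ a1.
rewrite (@continuous_FTC2 _ _ F)//.
- by rewrite /F/= powR0 ?gt_eqF// powR1 scaler0 sube0 /GRing.scale/= mulr1.
- exact: continuous_within_powR01.
- split.
  + by move=> x; rewrite in_itv/= => /andP[x0 _]; exact: (@ex_derive _ _ _ _ _ _ _ (d x x0)).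
  + by apply: cvgMl_tmp.
  + by apply: cvgMl_tmp.
- move=> x; rewrite in_itv/= => /andP[x0 _]; rewrite derive1E.
  by exact: (@derive_val _ _ _ _ _ _ _ (d x x0)).
Qed.

Lemma measurable_beta1_pdf (theta : R) :
  measurable_fun setT (beta1_pdf theta).
Proof.
rewrite /beta1_pdf; apply: measurable_funM => //.
apply: measurable_funM => //.
apply: (measurableT_comp (measurable_powR (theta - 1))).
exact: measurable_funB.
Qed.

Lemma beta1_pdf_ge0 (theta x : R) : 0 <= theta -> 0 <= beta1_pdf theta x.
Proof. by move=> t0; rewrite /beta1_pdf !mulr_ge0// powR_ge0. Qed.

(** The condition on j makes the exponent theta + j - 1 positive, so that the
integrand is continuous up to the endpoint x = 1 even when theta < 1. For j = 0
the value 1 comes instead from the total mass of the law. *)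
Lemma beta1_pdf_moment (theta : R) (j : nat) : 0 < theta -> (0 < j)%N ->
  (\int[lebesgue_measure]_x (beta1_pdf theta x * `|1 - x| ^+ j)%:E =
   (theta / (theta + j%:R))%:E)%E.
Proof.
move=> t0 j0; have a0 : 0 < theta + j%:R - 1.
  by rewrite -addrA ltr_wpDr// subr_ge0 ler1n.
have pdfM (x : R) : beta1_pdf theta x * `|1 - x| ^+ j =
    theta * (1 - x) `^ (theta + j%:R - 1) * \1_`[0, 1] x.
  rewrite /beta1_pdf mulrAC !indicE.
  case: (boolP (_ \in _)); rewrite ?mulr1 ?mulr0// inE/= in_itv/= => /andP[_ x1].
  rewrite -mulrA; congr (_ * _).
  have [->|xn1] := eqVneq x 1.
    by rewrite subrr normr0 expr0n gtn_eqF// mulr0 powR0// gt_eqF.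
  rewrite ger0_norm ?subr_ge0// -powR_mulrn ?subr_ge0// -powRD.
    by rewrite addrAC.
  by rewrite [1 - x == 0]subr_eq0 (eq_sym 1) xn1 implybT.
under eq_integral do rewrite pdfM.
rewrite -integral_indic_weight.
under eq_integral do rewrite EFinM.
rewrite ge0_integralZl//; last 3 first.
- apply: measurable_funTS; apply/measurable_EFinP.
  apply: (measurableT_comp (measurable_powR _)).
  exact: measurable_funB.
- by move=> x _; rewrite lee_fin powR_ge0.
- exact: ltW.
have := @integration_by_substitution_onem R (fun x => x `^ (theta + j%:R - 1)) 1.
rewrite /unstable.onem subrr ler01 lexx => /(_ isT) <-.
  by rewrite integral_powR01// subrK EFinM.
exact: continuous_within_powR01.
Qed.
End powR_integral.

(** * The maximum of a GEM sample through moments *)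

(** The integral of (1 - U) ^ n sees U only through its moments. This is the
bridge between two variables, on different spaces, that share their moments:
the residual stick length and the exponential of minus a Gamma variable. *)
Lemma integral_onemX {d : measure_display} {T : measurableType d}
    {R : realType} (mu : {measure set T -> \bar R}) (h U : T -> R)
    (c : nat -> R) (n : nat) :
  measurable_fun setT h -> measurable_fun setT U ->
  (forall t, 0 <= h t) -> (forall t, 0 <= U t) ->
  (forall j, (\int[mu]_t (h t * U t ^+ j)%:E = (c j)%:E)%E) ->
  (\int[mu]_t (h t * (1 - U t) ^+ n)%:E =
   (\sum_(j < n.+1) (-1) ^+ j * 'C(n, j)%:R * c j)%:E)%E.
Proof.
move=> mh mU h0 U0 hU.
have mhU j : measurable_fun setT (fun t => h t * U t ^+ j).
  by apply: measurable_funM => //; exact: measurable_funX.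
have ihU j : mu.-integrable setT (EFin \o (fun t => h t * U t ^+ j)).
  apply/integrableP; split; first exact/measurable_EFinP.
  under eq_integral do rewrite /= ger0_norm ?mulr_ge0 ?exprn_ge0//.
  by rewrite hU ltry.
transitivity (\int[mu]_t (\sum_(j < n.+1)
   ((-1) ^+ j * 'C(n, j)%:R)%:E * (h t * U t ^+ j)%:E))%E.
  apply: eq_integral => t _.
  under [RHS]eq_bigr do rewrite -EFinM.
  rewrite sumEFin; congr EFin.
  rewrite exprDn mulr_sumr; apply: eq_bigr => j _.
  rewrite expr1n mul1r (exprNn (U t)) -mulr_natr.
  by rewrite mulrCA -!mulrA; congr (_ * _); rewrite mulrCA [RHS]mulrCA [_ * U t ^+ j]mulrC.
rewrite integral_sum//.
  rewrite -sumEFin; apply: eq_bigr => j _.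
  by rewrite integralZl//; [rewrite hU|exact: ihU].
by move=> j; apply: integrableZl => //; exact: ihU.
Qed.

Section beta1_law.
Context {d : measure_display} {T : measurableType d} {R : realType}
  {P : probability T R} (theta : R) (X : {RV P >-> R}).
Hypothesis theta_gt0 : 0 < theta.
Hypothesis X_beta : forall A : set R, measurable A ->
  distribution P X A =
    (\int[lebesgue_measure]_(x in A) (beta1_pdf theta x)%:E)%E.

Lemma beta1_law_moment j :
  (\int[P]_t (`|1 - X t| ^+ j)%:E = (theta / (theta + j%:R))%:E)%E.
Proof.
case: j => [|j].
  under eq_integral do rewrite expr0.
  by rewrite integral_cst//= probability_setT mule1 addr0 divff ?gt_eqF.
rewrite -beta1_pdf_moment//.
transitivity (\int[P]_t (cst 1 t * `|1 - X t| ^+ j.+1)%:E)%E.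
  by apply: eq_integral => t _; rewrite mul1r.
apply: (@ge0_eq_integral_weight _ _ _ _ _ _ R P lebesgue_measure
  (cst 1) (beta1_pdf theta) X id _ _ _ _ _ _ _ (fun x : R => `|1 - x| ^+ j.+1)) => //.
- exact: measurable_beta1_pdf.
- by move=> x; rewrite beta1_pdf_ge0// ltW.
- move=> A mA; transitivity (distribution P X A); last first.
    by rewrite X_beta// integral_indic_weight.
  rewrite /distribution/= /pushforward -[in RHS](setIT (X @^-1` A)).
  rewrite -integral_indic//.
    by apply: eq_integral => t _; rewrite mul1r.
  by rewrite -[X in measurable X]setTI; exact: measurable_funP.
- apply: measurable_funX; apply: measurableT_comp => //.
  exact: measurable_funB.
Qed.

Lemma beta1_law_onem_ge0 : {ae P, forall t, 0 <= 1 - X t}.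
Proof.
exists (X @^-1` `]1, +oo[); split.
- by rewrite -[X in measurable X]setTI; exact: measurable_funP.
- change (distribution P X `]1, +oo[ = 0%E); rewrite X_beta//.
  apply: integral0_eq => x; rewrite /= in_itv/= andbT => x1.
  rewrite /beta1_pdf indicE memNset ?mulr0//= in_itv/= => /andP[_].
  by rewrite leNgt x1.
- by move=> t /=; rewrite in_itv/= andbT subr_ge0 => /negP; rewrite -ltNge.
Qed.

End beta1_law.

(** The conditional product rule is used only on the whole space, where the
integral of a conditional probability is the probability itself. *)
Lemma cond_iid_max_le {d : measure_display} {T : measurableType d}
    {R : realType} {P : probability T R} (G : set (set T))
    (X : nat -> {RV P >-> nat}) (F : T -> R) (n k : nat) :
  G setT ->
  cond_independent P G (fun i => X i : T -> nat) ->
  (forall i, is_cond_prob P G [set t | (X i t <= k)%N] F) ->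
  (P [set t | (sample_max X n t <= k)%N] = \int[P]_t (F t ^+ n)%:E)%E.
Proof.
move=> GT indep law.
pose J := [fset i in iota 0 n]%fset.
pose A (j : nat) : set nat := [set x | (x <= k)%N].
have [_ _ /(_ setT GT)] := indep J A (fun _ => F) (fun _ => I) (fun j _ => law j).
have -> : \bigcap_(j in [set` J]) (X j @^-1` A j) = [set t | (sample_max X n t <= k)%N].
  apply/seteqP; split => t /=.
  - move=> XA; apply/bigmax_leqP => i _; apply: (XA i).
    by rewrite /= inE /= mem_iota /= add0n ltn_ord.
  - move=> /bigmax_leqP XA j /=; rewrite inE /= mem_iota /= add0n => jn.
    exact: (XA (Ordinal jn)).
rewrite integral_indic ?setIT//.
  move=> <-; apply: eq_integral => t _; congr EFin.
  by rewrite big_fset_iota prodr_const card_ord.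
have := measurable_sample_max X n measurableT => /(_ (A 0%N) I).
by rewrite setTI.
Qed.

Section gem.
Context {d : measure_display} {T : measurableType d} {R : realType}
  {P : probability T R} (theta : R) (H : nat -> {RV P >-> R}).
Hypothesis theta_gt0 : 0 < theta.
Hypothesis H_indep : mutually_independent P (fun i => H i : T -> R).
Hypothesis H_beta : forall (i : nat) (A : set R), measurable A ->
  distribution P (H i) A =
    (\int[lebesgue_measure]_(x in A) (beta1_pdf theta x)%:E)%E.

Lemma gem_residual_moment k j :
  (\int[P]_t ((\prod_(i < k) `|1 - H i t|) ^+ j)%:E =
   ((theta / (theta + j%:R)) ^+ k)%:E)%E.
Proof.
transitivity (\int[P]_t (\prod_(i < k) `|1 - H i t| ^+ j)%:E)%E.
  by apply: eq_integral => t _; rewrite prodrXl.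
rewrite (mutually_independent_integral_prod P (fun i => H i : T -> R)
   (fun _ x => `|1 - x| ^+ j) (fun _ => theta / (theta + j%:R)))//.
- by rewrite prodr_const card_ord.
- move=> i; apply: measurable_funX; apply: measurableT_comp => //.
  exact: measurable_funB.
- by move=> i; apply: (beta1_law_moment _ _ theta_gt0) => A mA; exact: H_beta.
Qed.

(** Absolute values make the residual length nonnegative everywhere, as
[integral_onemX] requires; they change nothing almost surely. *)
Lemma integral_stickX k n :
  (\int[P]_t (stick H k t ^+ n)%:E =
   (\sum_(j < n.+1) (-1) ^+ j * 'C(n, j)%:R * (theta / (theta + j%:R)) ^+ k)%:E)%E.
Proof.
have mH i : measurable_fun setT (fun t => 1 - H i t) by exact: measurable_funB.
rewrite -(@integral_onemX _ _ _ P (cst 1) (fun t => \prod_(i < k) `|1 - H i t|)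
  (fun j => (theta / (theta + j%:R)) ^+ k))//.
- apply: ae_eq_integral => //.
  + apply/measurable_EFinP/measurable_funX/measurable_funB => //.
    exact: measurable_bigprod.
  + apply/measurable_EFinP/measurable_funM => //.
    apply/measurable_funX/measurable_funB => //.
    by apply: measurable_bigprod => i; exact: measurableT_comp.
  + have := ae_foralln (fun i => beta1_law_onem_ge0 theta (H i) (H_beta i)).
    apply: filterS => t Ht _ /=; rewrite /stick mul1r; congr ((1 - _) ^+ _)%:E.
    by apply: eq_bigr => i _; rewrite ger0_norm.
- by apply: measurable_bigprod => i; exact: measurableT_comp.
- by move=> t; rewrite prodr_ge0.
- move=> j; rewrite -gem_residual_moment.
  by apply: eq_integral => t _; rewrite mul1r.
Qed.

Lemma gem_max_cdf (X : nat -> {RV P >-> nat}) n k :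
  cond_independent P (sigma_generated (stick H)) (fun i => X i : T -> nat) ->
  (forall i, is_cond_prob P (sigma_generated (stick H))
      [set t | (X i t <= k)%N] (stick H k)) ->
  (P [set t | (sample_max X n t <= k)%N] =
   (\sum_(j < n.+1) (-1) ^+ j * 'C(n, j)%:R * (theta / (theta + j%:R)) ^+ k)%:E)%E.
Proof.
move=> indep law; rewrite (cond_iid_max_le _ _ (stick H k) n k _ indep law).
  exact: integral_stickX.
by rewrite -(setD0 setT); apply: sigma_algebraCD; exact: sigma_algebra0.
Qed.

End gem.

(** * Affine changes of variables *)

(** Both sides are measures in A, and they agree on half-open intervals. *)
Lemma lebesgue_measure_affine {R : realType} (a b : R) (A : set R) :
  a != 0 -> measurable A ->
  (`|a|%:E * lebesgue_measure ((fun x : R => a * x + b)%R @^-1` A) =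
   lebesgue_measure A)%E.
Proof.
move=> a0 mA.
pose phi (x : measurableTypeR R) : measurableTypeR R := a * x + b.
have mphi : measurable_fun setT phi.
  by apply: measurable_funD => //; exact: measurable_funM.
have [nu nuE] : exists nu : {measure set (measurableTypeR R) -> \bar R},
    forall B, nu B = (`|a|%:E * lebesgue_measure (phi @^-1` B))%E.
  unshelve eexists.
    apply: (mscale (NngNum (normr_ge0 a)) (pushforward lebesgue_measure phi)).
    exact: mphi.
  by [].
rewrite -nuE; apply/esym; apply: lebesgue_measure_unique => // _ [[c e] _ <-] /=.
rewrite nuE.
rewrite lebesgue_measure_itv/= lte_fin.
have [a_gt0|a_lt0|aE] := ltgtP 0 a; last by rewrite aE eqxx in a0.
- have -> : phi @^-1` `]c, e] = `](c - b) / a, (e - b) / a]%classic.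
    apply/seteqP; split => x; rewrite /= !in_itv/= ltr_pdivrMr// ler_pdivlMr//;
    by rewrite ltrBlDr lerBrDr mulrC.
  rewrite lebesgue_measure_itv/= lte_fin ltr_pM2r ?invr_gt0// ltrD2r.
  case: ifPn => ce; last by rewrite mule0.
  by rewrite -!EFinB -EFinM gtr0_norm//; congr EFin; field.
- have -> : phi @^-1` `]c, e] = `[(e - b) / a, (c - b) / a[%classic.
    apply/seteqP; split => x; rewrite /= !in_itv/= ler_ndivrMr// ltr_ndivlMr//;
    by rewrite ltrBlDr lerBrDr mulrC andbC.
  rewrite lebesgue_measure_itv/= lte_fin ltr_nM2r ?invr_lt0// ltrD2r.
  case: ifPn => ce; last by rewrite mule0.
  by rewrite -!EFinB -EFinM ltr0_norm//; congr EFin; field.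
Qed.

Lemma ge0_integral_affine {R : realType} (a b : R) (f : R -> R) :
  a != 0 -> measurable_fun setT f -> (forall x, 0 <= f x) ->
  (\int[lebesgue_measure]_x (`|a| * f (a * x + b))%:E =
   \int[lebesgue_measure]_x (f x)%:E)%E.
Proof.
move=> a0 mf f0.
have mphi : measurable_fun setT (fun x : R => a * x + b).
  by apply: measurable_funD => //; exact: measurable_funM.
transitivity (\int[lebesgue_measure]_x (1 * f x)%:E)%E; last first.
  by under eq_integral do rewrite mul1r.
apply: (@ge0_eq_integral_weight _ _ _ _ _ _ R lebesgue_measure lebesgue_measure
  (cst `|a|) (cst 1) (fun x : R => a * x + b) id) => // A mA.
transitivity (lebesgue_measure A); last first.
  by under eq_integral do rewrite mul1r; rewrite integral_indic// setIT.
rewrite -(lebesgue_measure_affine _ b _ a0 mA).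
have mA' : measurable ((fun x : R => a * x + b) @^-1` A).
  by rewrite -[X in measurable X]setTI; exact: mphi.
transitivity (`|a|%:E * \int[lebesgue_measure]_x (\1_A (a * x + b))%:E)%E.
  rewrite -ge0_integralZl//.
    by apply/measurable_EFinP; exact: measurableT_comp.
congr (_ * _)%E; rewrite -[X in _ = _ X]setIT.
by rewrite -[RHS]integral_indic.
Qed.

(** * The centred and scaled Gamma weight *)

Section gamma_profile.
Context {R : realType}.
Implicit Types (m n : nat) (u : R).

(** The Gamma variable t expressed by its centred and scaled version u. The
minus sign turns large t, that is short residual sticks, into small u, so that
the limit of the weights is the indicator of a lower half-line. *)
Definition gamma_arg m u : R := m%:R - Num.sqrt m%:R * u.

(** The function t ^ m exp(- t) on t > 0, divided by its maximal value
m ^ m exp(- m), at t = [gamma_arg] m u. For m = 0 this argument vanishes and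
the profile is identically 0. *)
Definition gamma_profile m u : R :=
  (gamma_arg m u / m%:R) ^+ m * expR (m%:R - gamma_arg m u) *
  \1_`]0, +oo[ (gamma_arg m u).

Lemma gamma_profileE m u : 0 < gamma_arg m u ->
  gamma_profile m u =
  (gamma_arg m u / m%:R) ^+ m * expR (m%:R - gamma_arg m u).
Proof.
by move=> t0; rewrite /gamma_profile indicE mem_set ?mulr1//= in_itv/= t0.
Qed.

Lemma gamma_profile_eq0 m u : gamma_arg m u <= 0 -> gamma_profile m u = 0.
Proof.
move=> t0; rewrite /gamma_profile indicE memNset ?mulr0//= in_itv/= andbT.
by apply/negP; rewrite -leNgt.
Qed.

Lemma gamma_profile_ge0 m u : 0 <= gamma_profile m u.
Proof.
have [t0|/gamma_profile_eq0->//] := ltP 0 (gamma_arg m u).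
by rewrite gamma_profileE// mulr_ge0 ?expR_ge0// exprn_ge0// divr_ge0// ltW.
Qed.

Lemma measurable_gamma_arg m : measurable_fun setT (gamma_arg m).
Proof. by apply: measurable_funB => //; exact: measurable_funM. Qed.

Lemma measurable_gamma_profile m : measurable_fun setT (gamma_profile m).
Proof.
have mt := measurable_gamma_arg m.
apply: measurable_funM; last first.
  by apply: measurableT_comp => //; exact: measurable_indic.
apply: measurable_funM.
  by apply: measurable_funX; exact: measurable_funM.
by apply: measurableT_comp => //; exact: measurable_funB.
Qed.

(** Multiplying t ^ m exp(- t) by exp(- j t / theta) amounts to rescaling t by
a = (theta + j) / theta, up to the factor a ^ (- m); the Jacobian accounts for
one more power. In the variable u this rescaling is an affine map. *)
Lemma gamma_profile_moment (theta I : R) m j : 0 < theta ->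
  (\int[lebesgue_measure]_u (gamma_profile m u)%:E = I%:E)%E ->
  (\int[lebesgue_measure]_u
     (gamma_profile m u * expR (- (gamma_arg m u / theta)) ^+ j)%:E =
   ((theta / (theta + j%:R)) ^+ m.+1 * I)%:E)%E.
Proof.
move=> t0 gI.
have tj0 : 0 < theta + j%:R by rewrite ltr_wpDr.
pose a := (theta + j%:R) / theta.
have a0 : 0 < a by rewrite divr_gt0.
pose c := (theta / (theta + j%:R)) ^+ m.+1.
have ca : c * a ^+ m.+1 = 1.
  by rewrite /c -exprMn /a mulrA divfK ?gt_eqF// divff ?gt_eqF// expr1n.
rewrite EFinM -gI -ge0_integralZl//=; last 3 first.
- by apply/measurable_EFinP; exact: measurable_gamma_profile.
- by move=> u _; rewrite lee_fin gamma_profile_ge0.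
- by rewrite lee_fin exprn_ge0// divr_ge0// ltW.
rewrite -(ge0_integral_affine a ((1 - a) * Num.sqrt m%:R) (fun u => c * gamma_profile m u)).
- apply: eq_integral => u _; congr EFin.
  have argE : gamma_arg m (a * u + (1 - a) * Num.sqrt m%:R) = a * gamma_arg m u.
    rewrite /gamma_arg mulrDr [_ * (_ * Num.sqrt _)]mulrCA -expr2 sqr_sqrtr//; ring.
  have [tu|tu] := ltP 0 (gamma_arg m u); last first.
    rewrite !gamma_profile_eq0 ?argE ?mulr0 ?mul0r//.
    by rewrite pmulr_rle0.
  have tau : 0 < gamma_arg m (a * u + (1 - a) * Num.sqrt m%:R).
    by rewrite argE mulr_gt0.
  rewrite (gamma_profileE _ _ tu) (gamma_profileE _ _ tau) argE gtr0_norm//.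
  have -> : expR (m%:R - a * gamma_arg m u) =
      expR (m%:R - gamma_arg m u) * expR (- (gamma_arg m u / theta)) ^+ j.
    rewrite -expRM_natl -expRD; congr expR; rewrite /a; field.
    by rewrite gt_eqF.
  rewrite -[a * _ / _]mulrA [(a * _) ^+ m]exprMn -[LHS]mul1r -ca exprS.
  by move: (_ ^+ m) (_ ^+ j) => *; ring.
- by rewrite gt_eqF.
- by apply: measurable_funM => //; exact: measurable_gamma_profile.
- by move=> u; rewrite mulr_ge0 ?gamma_profile_ge0// exprn_ge0// divr_ge0// ltW.
Qed.

Lemma gamma_profile_onemX (theta I : R) m n : 0 < theta ->
  (\int[lebesgue_measure]_u (gamma_profile m u)%:E = I%:E)%E ->
  (\int[lebesgue_measure]_u
     (gamma_profile m u * (1 - expR (- (gamma_arg m u / theta))) ^+ n)%:E =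
   ((\sum_(j < n.+1) (-1) ^+ j * 'C(n, j)%:R * (theta / (theta + j%:R)) ^+ m.+1)
     * I)%:E)%E.
Proof.
move=> t0 gI.
rewrite (@integral_onemX _ _ _ lebesgue_measure (gamma_profile m)
  (fun u => expR (- (gamma_arg m u / theta)))
  (fun j => (theta / (theta + j%:R)) ^+ m.+1 * I)).
- by congr EFin; rewrite mulr_suml; apply: eq_bigr => j _; rewrite mulrA.
- exact: measurable_gamma_profile.
- apply: measurableT_comp => //; apply: measurableT_comp => //.
  by apply: measurable_funM => //; exact: measurable_gamma_arg.
- exact: gamma_profile_ge0.
- by move=> u; exact: expR_ge0.
- by move=> j; exact: gamma_profile_moment.
Qed.

End gamma_profile.

Section profile_asymptotics.
Context {R : realType}.
Implicit Types (m n : nat) (u v x : R).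

(** With r ^ 2 = t / m, the inequality r <= exp(r - 1) bounds the profile by
exp(- p ^ 2) where p = sqrt m (r - 1). Since |u| = |p| (r + 1) is at most
2 |p| + p ^ 2 for m >= 1, this Gaussian decay in p is an exponential decay
in u, with constants that do not depend on m. *)
Lemma gamma_profile_le m u : gamma_profile m u <= expR (1 - `|u| / 2).
Proof.
have [t0|/gamma_profile_eq0->] := ltP 0 (gamma_arg m u); last exact: expR_ge0.
have [m0|m_gt0] := posnP m.
  by move: t0; rewrite /gamma_arg m0 sqrtr0 mul0r subrr ltxx.
have M0 : 0 < m%:R :> R by rewrite ltr0n.
rewrite gamma_profileE//.
pose s := Num.sqrt (m%:R : R); have s0 : 0 < s by rewrite sqrtr_gt0.
have sE : s ^+ 2 = m%:R by rewrite sqr_sqrtr// ltW.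
pose r := Num.sqrt (gamma_arg m u / m%:R).
have r0 : 0 <= r by rewrite sqrtr_ge0.
have rE : r ^+ 2 = gamma_arg m u / m%:R.
  by rewrite sqr_sqrtr// divr_ge0// ltW.
pose p := s * (r - 1).
have uE : u = - p * (r + 1).
  apply: (mulfI (lt0r_neq0 s0)).
  rewrite [RHS](_ : _ = s ^+ 2 * (1 - r ^+ 2)); last by rewrite /p; ring.
  by rewrite rE sE mulrBr mulr1 mulrCA divff ?gt_eqF// mulr1 /gamma_arg opprB addrC subrK.
(* m (r ^ 2 - 1) = t - m, and r ^ (2 m) <= exp(2 m (r - 1)); the exponents add
   up to - m (r - 1) ^ 2. *)
apply: (@le_trans _ _ (expR (- p ^+ 2))).
  have -> : m%:R - gamma_arg m u = m%:R * (1 - r ^+ 2).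
    by rewrite rE mulrBr mulr1 mulrCA divff ?gt_eqF// mulr1.
  have rle : gamma_arg m u / m%:R <= expR (2 * (r - 1)).
    rewrite -rE expRM_natl lerXn2r ?nnegrE ?expR_ge0//.
    by have := expR_ge1Dx (r - 1); rewrite addrC subrK.
  have -> : - p ^+ 2 = m%:R * (2 * (r - 1)) + m%:R * (1 - r ^+ 2).
    by rewrite /p exprMn sE; ring.
  rewrite expRD ler_wpM2r ?expR_ge0// expRM_natl lerXn2r// ?nnegrE ?expR_ge0//.
  by rewrite divr_ge0// ltW.
rewrite ler_expR.
have upE : `|u| <= 2 * `|p| + p ^+ 2.
  rewrite uE normrM normrN (ger0_norm (_ : 0 <= r + 1)) ?addr_ge0//.
  have -> : 2 * `|p| + p ^+ 2 = `|p| * (`|p| + 2) by rewrite -(real_normK (num_real p)); ring.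
  rewrite ler_wpM2l//.
  have s1 : 1 <= s by rewrite -sqrtr1 ler_wsqrtr// ler1n.
  have : r - 1 <= `|p|.
    apply: le_trans (ler_norm _) _.
    by rewrite /p normrM ler_peMl// ger0_norm// ltW.
  lra.
have := real_normK (num_real p); move: (`|p|) upE => q upE qE; nra.
Qed.

(** Mean value theorem for y |-> ln y - y + (y - 1) ^ 2 / 2, whose derivative is
(y - 1) ^ 2 / y. *)
Lemma ln1D_second_order v : `|v| <= 1 / 2 ->
  `|ln (1 + v) - v + v ^+ 2 / 2| <= 2 * `|v| ^+ 3.
Proof.
move=> v12.
pose f : R -> R := @ln R - id + 2^-1 \*: ((id - cst 1) ^+ 2).
pose df (y : R) := (y - 1) ^+ 2 / y.
have fE y : f (1 + y) = ln (1 + y) - y + y ^+ 2 / 2 - 1.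
  by rewrite /f /= !fctE /= /GRing.scale/=; field.
have fd (y : R) : 0 < y -> is_derive y 1 f (df y).
  move=> y0; have dln := is_derive1_ln y0.
  apply: is_derive_eq.
  rewrite /df !fctE /= /GRing.scale/= expr1; field.
  by rewrite gt_eqF.
have fMVT (a b : R) : 0 < a -> a <= b ->
    exists2 c, c \in `[a, b] & f b - f a = df c * (b - a).
  move=> a0 ab; apply: MVT_segment => // [x|].
    rewrite in_itv/= => /andP[ax _]; apply: fd; exact: lt_trans ax.
  apply: derivable_within_continuous => x; rewrite in_itv/= => /andP[ax _].
  exact: (@ex_derive _ _ _ _ _ _ _ (fd x (lt_le_trans a0 ax))).
have v1 : -(1 / 2) <= v <= 1 / 2 by rewrite -ler_norml.
have f1 : f 1 = - 1.
  by rewrite -[1]addr0 fE addr0 ln1 subr0 expr0n/= mul0r !add0r.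
have [c cv fc] : exists2 c, `|c - 1| <= `|v| & f (1 + v) - f 1 = df c * v.
  have [v0|v0] := leP 0 v.
    have [||c] := fMVT 1 (1 + v) => //; first by rewrite lerDl.
    rewrite in_itv/= => /andP[c1 c2]; rewrite [1 + v]addrC addrK => ?; exists c => //.
    rewrite ger0_norm ?subr_ge0// ger0_norm//; lra.
  have [||c] := fMVT (1 + v) 1 => //; [lra|lra|].
  rewrite in_itv/= => /andP[c1 c2] fc; exists c => //.
    rewrite ler0_norm ?subr_le0// ltr0_norm//; lra.
  by rewrite -opprB fc -mulrN; congr (_ * _); ring.
have -> : ln (1 + v) - v + v ^+ 2 / 2 = df c * v by rewrite -fc fE f1; ring.
have c12 : 1 / 2 <= c.
  by move: cv; rewrite ler_norml => /andP[? _]; lra.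
rewrite normrM exprSr mulrA ler_wpM2r//.
rewrite /df normrM normrX normfV (ger0_norm (_ : 0 <= c)); last by lra.
rewrite ler_pdivrMr; last by lra.
have : `|c - 1| ^+ 2 <= `|v| ^+ 2 by rewrite lerXn2r.
have : 0 <= `|v| ^+ 2 by rewrite exprn_ge0.
nra.
Qed.

End profile_asymptotics.

Section gamma_profile_limit.
Context {R : realType}.
Implicit Types (m n : nat) (u v x : R).

Lemma sqrt_nat_infty (A : R) : \forall m \near \oo, A <= Num.sqrt m%:R.
Proof.
near=> m; apply: (le_trans (ler_norm A)).
rewrite -sqrtr_sqr ler_wsqrtr//.
by near: m; exact: nbhs_infty_ger.
Unshelve. all: by end_near. Qed.

(** The logarithm of the profile is m (ln (1 + v) - v) with v = - u / sqrt m, and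
m v ^ 2 = u ^ 2. *)
Lemma gamma_profile_cvg u :
  gamma_profile m u @[m --> \oo] --> expR (- (u ^+ 2 / 2)).
Proof.
pose e m := m%:R * (ln (1 - u / Num.sqrt m%:R) + u / Num.sqrt m%:R) : R.
have near_s (A : R) : \forall m \near \oo, A <= Num.sqrt m%:R.
  exact: sqrt_nat_infty.
have ecvg : e m @[m --> \oo] --> - (u ^+ 2 / 2).
  apply/cvgrPdist_le => eps eps0; near=> m.
  have s1 : 1 <= (Num.sqrt m%:R : R) by near: m; exact: near_s.
  have su : 2 * `|u| <= Num.sqrt m%:R by near: m; exact: near_s.
  have se : 2 * `|u| ^+ 3 / eps <= Num.sqrt m%:R by near: m; exact: near_s.
  pose s : R := Num.sqrt m%:R; rewrite -/s in s1 su se.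
  have s0 : 0 < s by lra.
  have sE : s ^+ 2 = m%:R by rewrite sqr_sqrtr.
  have vE : `| - (u / s)| = `|u| / s by rewrite normrN normrM normfV (ger0_norm (ltW s0)).
  have /ln1D_second_order : `| - (u / s)| <= 1 / 2.
    by rewrite vE ler_pdivrMr//; lra.
  rewrite vE /e -/s -sE => h.
  have -> : - (u ^+ 2 / 2) - s ^+ 2 * (ln (1 - u / s) + u / s) =
     - (s ^+ 2 * (ln (1 - u / s) - - (u / s) + (- (u / s)) ^+ 2 / 2)).
    by field; rewrite gt_eqF.
  rewrite normrN normrM (ger0_norm (sqr_ge0 s)).
  apply: (le_trans (ler_wpM2l (sqr_ge0 s) h)).
  move: (`|u|) se => w se.
  rewrite (_ : s ^+ 2 * (2 * (w / s) ^+ 3) = 2 * w ^+ 3 / s); last first.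
    by field; rewrite gt_eqF.
  by rewrite ler_pdivrMr// -ler_pdivrMl// mulrC.
have {}ecvg : expR (e m) @[m --> \oo] --> expR (- (u ^+ 2 / 2)).
  by apply: continuous_cvg => //; exact: continuous_expR.
apply: (cvg_trans _ ecvg); apply: near_eq_cvg; near=> m.
have s1 : 1 <= (Num.sqrt m%:R : R) by near: m; exact: near_s.
have su : 2 * `|u| + 1 <= Num.sqrt m%:R by near: m; exact: near_s.
pose s : R := Num.sqrt m%:R; rewrite -/s in s1 su.
have s0 : 0 < s by lra.
have sE : s ^+ 2 = m%:R by rewrite sqr_sqrtr.
have us : u < s by have := ler_norm u; have := normr_ge0 u; lra.
have aE : gamma_arg m u = s ^+ 2 * (1 - u / s).
  by rewrite /gamma_arg -/s -sE; field; rewrite gt_eqF.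
have v0 : 0 < 1 - u / s by rewrite subr_gt0 ltr_pdivrMr// mul1r.
rewrite gamma_profileE ?aE ?mulr_gt0 ?exprn_gt0// /e -/s.
rewrite mulrDr expRD expRM_natl lnK ?posrE// -sE; congr (_ * _).
  by rewrite mulrAC divff ?mul1r// gt_eqF// exprn_gt0.
by congr expR; ring.
Unshelve. all: by end_near. Qed.

Lemma integrable_expR_abs :
  lebesgue_measure.-integrable setT (EFin \o (fun u : R => expR (1 - `|u| / 2))).
Proof.
have half0 : (0 : R) < 1 / 2 by lra.
have ie := @integrable_exponential_pdf R (1 / 2) half0.
have me := @measurable_exponential_pdf R (1 / 2).
have e0 u : 0 <= exponential_pdf (1 / 2) u by apply: exponential_pdf_ge0; lra.
(* exp(- |u| / 2) is twice the exponential density of rate 1 / 2 at |u|. *)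
pose c : R := 2 * expR 1.
have c0 : 0 <= c by rewrite mulr_ge0// expR_ge0.
have ieN : lebesgue_measure.-integrable setT
    (EFin \o (fun u : R => exponential_pdf (1 / 2) (- u))).
  apply/integrableP; split.
    by apply/measurable_EFinP; exact: measurableT_comp.
  have := ge0_integral_affine (-1) 0 _ _ me e0.
  rewrite oppr_eq0 oner_eq0 => /(_ isT) h.
  under eq_integral do rewrite /= ger0_norm//.
  rewrite (_ : (\int[_]_x _)%E = (\int[lebesgue_measure]_x (exponential_pdf (1 / 2) x)%:E)%E).
    by rewrite integral_exponential_pdf// ltry.
  rewrite -h; apply: eq_integral => u _.
  by rewrite normrN normr1 !mul1r addr0 mulN1r.
have bound u : expR (1 - `|u| / 2) <=
    c * (exponential_pdf (1 / 2) u + exponential_pdf (1 / 2) (- u)).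
  rewrite expRD /c -mulrA mulrCA ler_wpM2l ?expR_ge0//.
  have [u0|u0] := leP 0 u.
    have := e0 (- u); rewrite (exponential_pdfE _ u0) ger0_norm//.
    rewrite (_ : - (1 / 2) * u = - (u / 2)); last by ring.
    by move: (expR _) (exponential_pdf _ _) => a b; lra.
  have := e0 u; rewrite (@exponential_pdfE _ _ (- u)) ?oppr_ge0 ?(ltW u0)// ltr0_norm//.
  rewrite (_ : - (1 / 2) * - u = - (- u / 2)); last by ring.
  by move: (expR _) (exponential_pdf _ _) => a b; lra.
apply: (le_integrable measurableT _ _
    (integrableZl measurableT c (integrableD measurableT ie ieN))).
  apply/measurable_EFinP; apply: measurableT_comp => //.
  by apply: measurable_funB => //; apply: measurable_funM.
move=> u _; rewrite /= lee_fin (ger0_norm (expR_ge0 _)).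
by apply: (le_trans (bound u)); rewrite ler_norm.
Qed.

End gamma_profile_limit.

(** * Passage to the limit *)

Section profile_limit.
Context {R : realType}.
Implicit Types (m n : nat) (u v x : R).

(** The bounds on the weight are only required where the profile is nonzero:
for t < 0 the quantity 1 - exp(- t / theta) would be negative. *)
Lemma cvg_integral_gamma_profile (m_ : nat -> nat) (w : nat -> R -> R)
    (w' : R -> R) x :
  m_ n @[n --> \oo] --> \oo ->
  (forall n, measurable_fun setT (w n)) -> measurable_fun setT w' ->
  (forall n u, 0 < gamma_arg (m_ n) u -> 0 <= w n u <= 1) ->
  (forall u, u != x -> w n u @[n --> \oo] --> w' u) ->
  (\int[lebesgue_measure]_u (gamma_profile (m_ n) u * w n u)%:E @[n --> \oo] -->
   \int[lebesgue_measure]_u (expR (- (u ^+ 2 / 2)) * w' u)%:E)%E.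
Proof.
move=> m_oo mw mw' w01 ww'.
have mf n : measurable_fun setT (fun u => (gamma_profile (m_ n) u * w n u)%:E).
  apply/measurable_EFinP/measurable_funM => //.
  exact: measurable_gamma_profile.
have mf' : measurable_fun setT (fun u => (expR (- (u ^+ 2 / 2)) * w' u)%:E).
  apply/measurable_EFinP/measurable_funM => //.
  apply: measurableT_comp => //; apply: measurableT_comp => //.
  by apply: measurable_funM.
have fcvg : {ae lebesgue_measure, forall u, setT u ->
    (gamma_profile (m_ n) u * w n u)%:E @[n --> \oo] -->
    (expR (- (u ^+ 2 / 2)) * w' u)%:E}.
  exists [set x]; split => //; first exact: lebesgue_measure_set1.
  move=> u /= nu; apply: contrapT => /eqP ux; apply: nu => _.
  apply: cvg_EFin; first exact: nearW.
  apply: cvgM; last exact: ww'.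
  exact: (cvg_comp _ _ m_oo (gamma_profile_cvg u)).
have bound n u : `|gamma_profile (m_ n) u * w n u| <= expR (1 - `|u| / 2).
  apply: le_trans (gamma_profile_le (m_ n) u).
  have [t0|t0] := ltP 0 (gamma_arg (m_ n) u); last first.
    by rewrite gamma_profile_eq0// mul0r normr0.
  have /andP[w0 w1] := w01 n u t0; have g0 := gamma_profile_ge0 (m_ n) u.
  rewrite ger0_norm; last exact: mulr_ge0.
  by rewrite ler_piMr.
have fbound : {ae lebesgue_measure, forall u n, setT u ->
    (`|(gamma_profile (m_ n) u * w n u)%:E| <= (expR (1 - `|u| / 2))%:E)%E}.
  by apply: aeW => t k _; rewrite lee_fin; exact: bound.
by have [_ _] := @dominated_convergence _ (measurableTypeR R) R lebesgue_measure
  setT measurableT _ _ _ mf mf' fcvg integrable_expR_abs fbound.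
Qed.

Lemma onemX_ge (z : R) n : 0 <= z <= 1 -> 1 - n%:R * z <= (1 - z) ^+ n.
Proof.
move=> /andP[z0 z1]; elim: n => [|n IHn]; first by rewrite mul0r subr0.
rewrite exprS; apply: le_trans (ler_wpM2l _ IHn); last by rewrite subr_ge0.
have : 0 <= n%:R * z ^+ 2 by rewrite mulr_ge0// exprn_ge0.
by rewrite -natr1; lra.
Qed.

Lemma onemX_le_expR (z : R) n : z <= 1 -> (1 - z) ^+ n <= expR (- (n%:R * z)).
Proof.
move=> z1; rewrite -mulrN expRM_natl lerXn2r ?nnegrE ?expR_ge0 ?subr_ge0//.
exact: expR_ge1Dx.
Qed.

(** With z = exp(- t / theta), one has n z = exp(sqrt m (u - r) / theta) where r
is the normalized index, which tends to x. So n z tends to 0 or to infinity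
according to the sign of u - x, and (1 - z) ^ n lies between 1 - n z and
exp(- n z). *)
Lemma gamma_weight_cvg (theta : R) (m_ : nat -> nat) x u : 0 < theta ->
  m_ n @[n --> \oo] --> \oo ->
  ((m_ n)%:R - theta * ln n%:R) / Num.sqrt (m_ n)%:R @[n --> \oo] --> x ->
  u != x ->
  (1 - expR (- (gamma_arg (m_ n) u / theta))) ^+ n @[n --> \oo] -->
  (\1_`]-oo, x] u : R).
Proof.
move=> t0 m_oo r_x ux.
have near_s (A : R) : \forall n \near \oo, A <= Num.sqrt (m_ n)%:R.
  exact: (m_oo _ (sqrt_nat_infty A)).
pose r n : R := ((m_ n)%:R - theta * ln n%:R) / Num.sqrt (m_ n)%:R.
pose z n := expR (- (gamma_arg (m_ n) u / theta)).
have nzE n : (0 < n)%N -> 0 < Num.sqrt (m_ n)%:R :> R ->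
    n%:R * z n = expR (Num.sqrt (m_ n)%:R * (u - r n) / theta).
  move=> n0 s0; rewrite -{1}[n%:R]lnK ?posrE ?ltr0n// -expRD; congr expR.
  rewrite /gamma_arg /r; have := sqr_sqrtr (ler0n R (m_ n)).
  move: (Num.sqrt _) s0 => s s0 <-.
  by field; rewrite !gt_eqF.
have z01 : \forall n \near \oo, 0 <= z n <= 1.
  near=> n; rewrite expR_ge0/= -expR0 ler_expR oppr_le0 divr_ge0 ?(ltW t0)//.
  have s0 : `|u| <= Num.sqrt (m_ n)%:R by near: n; exact: near_s.
  rewrite /gamma_arg -{1}[(m_ n)%:R]sqr_sqrtr// expr2 -mulrBr mulr_ge0//.
  by rewrite subr_ge0 (le_trans (ler_norm u)).
rewrite indicE; have [xu|xu] := ltP x u.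
  rewrite memNset/=; last by rewrite in_itv/= leNgt xu.
  apply/cvgrPdist_le => e e0; near=> n.
  have n0 : (0 < n)%N by near: n; exact: nbhs_infty_gt.
  have s0 : 1 <= (Num.sqrt (m_ n)%:R : R) by near: n; exact: near_s.
  have zn : 0 <= z n <= 1 by near: n; exact: z01.
  have rn : r n <= (u + x) / 2.
    near: n; apply: (cvgr_le _ r_x); lra.
  have se : 2 * theta * (- ln e) / (u - x) <= Num.sqrt (m_ n)%:R.
    by near: n; exact: near_s.
  rewrite -/(z n); have /andP[z0 z1] := zn.
  rewrite sub0r normrN ger0_norm; last by rewrite exprn_ge0// subr_ge0.
  apply: (le_trans (onemX_le_expR _ n z1)).
  rewrite nzE//; last by lra.
  (* n z >= - ln e once sqrt m exceeds the threshold in se. *)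
  rewrite -[leRHS](lnK e0) ler_expR lerNl.
  apply: le_trans (expR_ge1Dx _).
  rewrite -[leLHS]add0r lerD// ler_pdivlMr//.
  move: se; rewrite ler_pdivrMr ?subr_gt0// => se.
  have : Num.sqrt (m_ n)%:R * (u - x) <= Num.sqrt (m_ n)%:R * (2 * (u - r n)) :> R.
    by rewrite ler_wpM2l//; lra.
  by lra.
have {}xu : u < x by rewrite lt_neqAle ux.
rewrite mem_set/= ?in_itv//= ?(ltW xu)//.
apply/cvgrPdist_le => e e0; near=> n.
have n0 : (0 < n)%N by near: n; exact: nbhs_infty_gt.
have s0 : 1 <= (Num.sqrt (m_ n)%:R : R) by near: n; exact: near_s.
have zn : 0 <= z n <= 1 by near: n; exact: z01.
have rn : (u + x) / 2 <= r n.
  near: n; apply: (cvgr_ge _ r_x); lra.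
have se : 2 * theta * (- ln e) / (x - u) <= Num.sqrt (m_ n)%:R.
  by near: n; exact: near_s.
rewrite -/(z n); have /andP[z0 z1] := zn.
rewrite ger0_norm; last first.
  by rewrite subr_ge0 exprn_ile1// ?subr_ge0// gerBl.
apply: (@le_trans _ _ (n%:R * z n)).
  by have := onemX_ge _ n zn; lra.
rewrite nzE//; last by lra.
rewrite -[leRHS](lnK e0) ler_expR ler_pdivrMr//.
move: se; rewrite ler_pdivrMr ?subr_gt0// => se.
have : Num.sqrt (m_ n)%:R * (x - u) <= Num.sqrt (m_ n)%:R * (2 * (r n - u)) :> R.
  by rewrite ler_wpM2l//; lra.
by lra.
Unshelve. all: by end_near. Qed.

End profile_limit.

Section limit.
Context {R : realType}.
Implicit Types (m n : nat) (u v x : R).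

Lemma normal_pdf01E u :
  normal_pdf 0 1 u = normal_peak 1 * expR (- (u ^+ 2 / 2)).
Proof.
rewrite normal_pdfE ?oner_eq0// /normal_fun subr0 expr1n; congr (_ * expR _).
by rewrite mulNr.
Qed.

Lemma integral_gaussian_weight (f : R -> R) :
  measurable_fun setT f -> (forall u, 0 <= f u) ->
  (\int[lebesgue_measure]_u (expR (- (u ^+ 2 / 2)) * f u)%:E =
   ((@normal_peak R 1)^-1)%:E *
   \int[lebesgue_measure]_u (normal_pdf 0 1 u * f u)%:E)%E.
Proof.
move=> mf f0; have p0 : 0 < @normal_peak R 1 by rewrite normal_peak_gt0 ?oner_eq0.
rewrite -ge0_integralZl//.
- apply: eq_integral => u _; rewrite -EFinM; congr EFin.
  by rewrite normal_pdf01E -[X in _ = _ * X]mulrA mulKf// gt_eqF.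
- apply/measurable_EFinP/measurable_funM => //.
  exact: measurable_normal_pdf.
- by move=> u _; rewrite lee_fin mulr_ge0// normal_pdf_ge0.
- by rewrite lee_fin invr_ge0 ltW.
Qed.

Lemma integral_gamma_profile_fin_num m :
  (\int[lebesgue_measure]_u (gamma_profile m u : R)%:E)%E \is a fin_num.
Proof.
rewrite ge0_fin_numE; last first.
  by apply: integral_ge0 => u _; rewrite lee_fin gamma_profile_ge0.
have /integrableP[me] := @integrable_expR_abs R; apply: le_lt_trans.
apply: ge0_le_integral => //.
- by move=> u _; rewrite lee_fin gamma_profile_ge0.
- by apply/measurable_EFinP; exact: measurable_gamma_profile.
- exact: measurableT_comp.
- by move=> u _; rewrite lee_fin (le_trans (gamma_profile_le m u))// ler_norm.
Qed.

(** The alternating sum times the total mass of the profile is its weighted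
mass. Both masses converge by dominated convergence, and the limit of the total
mass is positive, so the sum tends to the quotient of the limits. *)
Lemma gem_sum_cvg (theta : R) (m_ : nat -> nat) x : 0 < theta ->
  m_ n @[n --> \oo] --> \oo ->
  ((m_ n)%:R - theta * ln n%:R) / Num.sqrt (m_ n)%:R @[n --> \oo] --> x ->
  \sum_(j < n.+1) (-1) ^+ j * 'C(n, j)%:R * (theta / (theta + j%:R)) ^+ (m_ n).+1
    @[n --> \oo] --> fine (normal_prob 0 1 `]-oo, x]).
Proof.
move=> t0 m_oo r_x.
set q := fun n : nat => \sum_(j < n.+1) _.
pose I n : R := fine (\int[lebesgue_measure]_u (gamma_profile (m_ n) u : R)%:E).
have IE n : (\int[lebesgue_measure]_u (gamma_profile (m_ n) u : R)%:E = (I n)%:E)%E.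
  by rewrite fineK// integral_gamma_profile_fin_num.
pose c : R := (normal_peak 1)^-1.
have c0 : 0 < c by rewrite invr_gt0 normal_peak_gt0 ?oner_eq0.
have I_cvg : I n @[n --> \oo] --> c.
  have : (\int[lebesgue_measure]_u (gamma_profile (m_ n) u * 1 : R)%:E @[n --> \oo] -->
      \int[lebesgue_measure]_u (expR (- (u ^+ 2 / 2)) * 1 : R)%:E)%E.
    apply: (cvg_integral_gamma_profile m_ (fun _ _ => 1) (fun _ => 1) x) => //.
    - by move=> n u _; rewrite ler01 lexx.
    - by move=> u _; exact: cvg_cst.
  rewrite integral_gaussian_weight//.
  under eq_integral do rewrite mulr1.
  rewrite integral_normal_pdf mule1 => /fine_cvg; apply: cvg_trans.
  apply: near_eq_cvg; apply: nearW => n; rewrite /I; congr fine.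
  by apply: eq_integral => u _; rewrite mulr1.
have qI_cvg : q n * I n @[n --> \oo] --> c * fine (normal_prob 0 1 `]-oo, x]).
  pose w n u : R := (1 - expR (- (gamma_arg (m_ n) u / theta))) ^+ n.
  have : (\int[lebesgue_measure]_u (gamma_profile (m_ n) u * w n u)%:E @[n --> \oo] -->
      \int[lebesgue_measure]_u (expR (- (u ^+ 2 / 2)) * \1_`]-oo, x] u)%:E)%E.
    apply: (cvg_integral_gamma_profile m_ w _ x) => //.
    - move=> n; apply: measurable_funX; apply: measurable_funB => //.
      apply: measurableT_comp => //; apply: measurableT_comp => //.
      by apply: measurable_funM => //; exact: measurable_gamma_arg.
    - move=> n u tu; have e1 : expR (- (gamma_arg (m_ n) u / theta)) <= 1.
        by rewrite -expR0 ler_expR oppr_le0 divr_ge0// ltW.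
      by rewrite exprn_ge0 ?subr_ge0//= exprn_ile1 ?subr_ge0// gerBl expR_ge0.
    - by move=> u ux; exact: gamma_weight_cvg.
  rewrite integral_gaussian_weight//.
  rewrite -integral_indic_weight -/(normal_prob 0 1 `]-oo, x]).
  have nfin : normal_prob (0 : R) 1 `]-oo, x] \is a fin_num.
    exact: fin_num_measure.
  rewrite -{1}(fineK nfin) -EFinM => /fine_cvg; apply: cvg_trans.
  apply: near_eq_cvg; apply: nearW => n /=.
  by rewrite (gamma_profile_onemX _ _ _ _ t0 (IE n)).
have : q n * I n / I n @[n --> \oo] --> c * fine (normal_prob 0 1 `]-oo, x]) / c.
  by apply: cvgM => //; apply: cvgV => //; rewrite gt_eqF.
rewrite mulrAC divff ?mul1r ?gt_eqF//; apply: cvg_trans.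
apply: near_eq_cvg; near=> n; rewrite mulfK// gt_eqF//.
by near: n; exact: (cvgr_gt _ I_cvg).
Unshelve. all: by end_near. Qed.

End limit.

(** * Rounding the normalized maximum *)

Lemma sqrt_ln_infty {R : realType} (theta A : R) : 0 < theta ->
  \forall n \near \oo, A <= Num.sqrt (theta * ln n%:R).
Proof.
move=> t0; near=> n.
have ln_ge : A ^+ 2 / theta <= ln n%:R.
  have en : expR (A ^+ 2 / theta) <= n%:R by near: n; exact: nbhs_infty_ger.
  by rewrite -[leLHS]expRK ler_ln ?posrE ?expR_gt0// (lt_le_trans _ en) ?expR_gt0.
apply: (le_trans (ler_norm A)).
rewrite -sqrtr_sqr ler_wsqrtr//.
by move: ln_ge; rewrite ler_pdivrMr// mulrC.
Unshelve. all: by end_near. Qed.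

(** For integers M, the event that the normalized value is at most x is
M <= floor(y) with y = theta ln n + x sqrt(theta ln n). The index is
m = floor(y) - 1, and (m - theta ln n) / sqrt m still tends to x because
sqrt m and sqrt(theta ln n) differ by a bounded amount. *)
Lemma normalized_le_index {R : realType} (theta x : R) : 0 < theta ->
  exists m_ : nat -> nat,
  [/\ m_ n @[n --> \oo] --> \oo,
      ((m_ n)%:R - theta * ln n%:R) / Num.sqrt (m_ n)%:R @[n --> \oo] --> x &
      \forall n \near \oo, forall M : nat,
        ((M%:R - theta * ln n%:R) / Num.sqrt (theta * ln n%:R) <= x) =
        (M <= (m_ n).+1)%N].
Proof.
move=> t0.
have near_s := fun A => sqrt_ln_infty theta A t0.
pose s n := Num.sqrt (theta * ln n%:R).
have sE : \forall n \near \oo, s n ^+ 2 = theta * ln n%:R.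
  near=> n; rewrite sqr_sqrtr// mulr_ge0 ?ln_ge0 ?(ltW t0)//.
  by rewrite ler1n; near: n; exact: nbhs_infty_gt.
pose y n := s n ^+ 2 + x * s n.
pose m_ n := (Num.truncn (y n)).-1.
have y_large (A : R) : \forall n \near \oo, A <= y n.
  near=> n; have s1 : `|A| <= s n by near: n; exact: near_s.
  have s2 : 1 - x <= s n by near: n; exact: near_s.
  apply: (le_trans (ler_norm A)); apply: (le_trans s1).
  have s0 : 0 <= s n by rewrite sqrtr_ge0.
  rewrite /y; nra.
have truncE : \forall n \near \oo, Num.truncn (y n) = (m_ n).+1.
  near=> n; rewrite /m_ prednK// truncn_gt0.
  by near: n; exact: y_large.
have m_bounds : \forall n \near \oo, y n - 2 <= (m_ n)%:R <= y n - 1.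
  near=> n.
  have yE : Num.truncn (y n) = (m_ n).+1 by near: n; exact: truncE.
  have y0 : 0 <= y n by near: n; exact: y_large.
  have := truncn_itv y0; rewrite yE -!natr1; lra.
have m_large (A : R) : \forall n \near \oo, A <= (m_ n)%:R.
  near=> n; have : A + 2 <= y n by near: n; exact: y_large.
  have /andP[] : y n - 2 <= (m_ n)%:R <= y n - 1 by near: n; exact: m_bounds.
  by lra.
have m_oo : m_ n @[n --> \oo] --> \oo.
  move=> P [B _ BP]; near=> n; apply: BP; rewrite /= -(ler_nat R).
  by near: n; exact: m_large.
exists m_; split => //.
- apply/cvgrPdist_le => e e0; near=> n.
  have : y n - 2 <= (m_ n)%:R <= y n - 1 by near: n; exact: m_bounds.
  have <- : s n ^+ 2 = theta * ln n%:R by near: n; exact: sE.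
  have : 1 <= s n by near: n; exact: near_s.
  have : (`|x| * (`|x| + 2) + 2) / e <= Num.sqrt (m_ n)%:R.
    near: n; exact: (m_oo _ (sqrt_nat_infty _)).
  have : 1 <= (Num.sqrt (m_ n)%:R : R).
    near: n; exact: (m_oo _ (sqrt_nat_infty _)).
  rewrite /y.
  have := sqr_sqrtr (ler0n R (m_ n)).
  move: (Num.sqrt _) (s n) => r t <- r1 re t1 /andP[m1 m2].
  have r0 : 0 < r by lra.
  have rs : `|r - t| <= `|x| + 2.
    (* r ^ 2 - t ^ 2 = x t - (y - m), where y - m lies in [1, 2]. *)
    rewrite -(ler_pM2r (_ : 0 < r + t)); last by lra.
    rewrite -{1}(ger0_norm (_ : 0 <= r + t)); last by lra.
    rewrite -normrM (_ : _ * _ = r ^+ 2 - t ^+ 2); last by ring.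
    have xs : `|x * t| = `|x| * t by rewrite normrM (ger0_norm (_ : 0 <= t))//; lra.
    have := ler_norm (x * t); have := ler_norm (- (x * t)).
    have := normr_ge0 x; rewrite normrN xs; move: (`|x|) => X X0 h1 h2.
    rewrite ler_norml; apply/andP; split; nra.
  have -> : x - (r ^+ 2 - t ^+ 2) / r = (x * (r - t) + (t ^+ 2 + x * t - r ^+ 2)) / r.
    by field; rewrite gt_eqF.
  rewrite normrM normfV (gtr0_norm r0) ler_pdivrMr//.
  move: re; rewrite ler_pdivrMr// => re.
  rewrite [leRHS]mulrC; apply: le_trans re.
  apply: (le_trans (ler_normD _ _)); rewrite normrM lerD ?ler_wpM2l//.
  by rewrite ger0_norm; lra.
- near=> n => M.
  have s1 : 1 <= Num.sqrt (theta * ln n%:R) by near: n; exact: near_s.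
  have sn : s n ^+ 2 = theta * ln n%:R by near: n; exact: sE.
  have yE : Num.truncn (y n) = (m_ n).+1 by near: n; exact: truncE.
  have y0 : 0 <= y n by near: n; exact: y_large.
  rewrite -yE truncn_ge_nat// ler_pdivrMr; last by lra.
  by rewrite lerBlDr /y sn addrC.
Unshelve. all: by end_near. Qed.

(** * Convergence in distribution *)

Theorem corollary1 (R : realType) (theta : R) (theta_gt0 : 0 < theta)
  (d : measure_display) (T : measurableType d) (P : probability T R)
  (H : nat -> {RV P >-> R}) (X : nat -> {RV P >-> nat})
  (H_indep : mutually_independent P (fun i => H i : T -> R))
  (H_beta : forall (i : nat) (A : set R), measurable A ->
    distribution P (H i) A =
      (\int[lebesgue_measure]_(x in A) (beta1_pdf theta x)%:E)%E)
  (X_gt0 : forall (i : nat) (t : T), (0 < X i t)%N)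
  (X_cond_indep :
    cond_independent P (sigma_generated (stick H)) (fun i => X i : T -> nat))
  (X_cond_law : forall i k : nat, (0 < k)%N ->
    is_cond_prob P (sigma_generated (stick H))
      [set t | (X i t <= k)%N] (stick H k))
  (d' : measure_display) (T' : measurableType d') (P' : probability T' R)
  (N : {RV P' >-> R})
  (N_normal : forall A : set R, measurable A ->
    distribution P' N A = normal_prob 0 1 A) :
  cvg_in_distribution
    (fun n => normalized_max theta X n : {RV P >-> R}) N.
Proof.
move=> x _.
have [m_ [m_oo r_x idx]] := normalized_le_index theta x theta_gt0.
have -> : cdf N x = (fine (normal_prob 0 1 `]-oo, x]))%:E.
  by rewrite /cdf N_normal// fineK// fin_num_measure.
apply: cvg_EFin; first by apply: nearW => n; rewrite fin_num_measure.
apply: cvg_trans (gem_sum_cvg theta m_ x theta_gt0 m_oo r_x); apply: near_eq_cvg; near=> n.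
have idxn : forall M : nat,
  ((M%:R - theta * ln n%:R) / Num.sqrt (theta * ln n%:R) <= x) =
  (M <= (m_ n).+1)%N by near: n; exact: idx.
transitivity (fine (P [set t | (sample_max X n t <= (m_ n).+1)%N])).
  rewrite (gem_max_cdf theta H theta_gt0 H_indep H_beta X n (m_ n).+1)//.
  by move=> i; exact: X_cond_law.
rewrite /= /cdf /distribution /pushforward; congr (fine (P _)).
by apply/seteqP; split => t; rewrite /= in_itv/= /normalized_max idxn.
Unshelve. all: by end_near. Qed.
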